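(* Let $a<b$ be real numbers and let $f\in C^2([a,b])$ be real-valued. Define $E^T(f)$ by $$\int_a^b f(x)\,dx=\frac{b-a}{2}\left[f(a)+f(b)\right]+E^T(f).$$ Then $$|E^T(f)|\leq \frac{(b-a)^3\|f''\|_\infty}{12}.$$ Moreover (composite trapezoidal rule), for every natural number $n\ge 1$, setting $x_i=a+(b-a)i/n$ for $0\leq i\leq n$ and defining $E^T_n(f)$ by $$\int_a^b f(x)\,dx=\frac{b-a}{2n}\left[f(a)+2\sum_{i=1}^{n-1}f(x_i)+f(b)\right]+E^T_n(f),$$ one has $$|E^T_n(f)|\leq\frac{(b-a)^3\|f''\|_\infty}{12n^2}.$$
   Context: $C^2([a,b])$ denotes the functions on $[a,b]$ that are continuous together with their derivatives up to order $2$ on $[a,b]$ (one-sided derivatives at the endpoints). $\|g\|_\infty=\sup_{x\in[a,b]}|g(x)|$ is the uniform norm on $[a,b]$. An empty sum is $0$. *)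

(* Defs.v *)
From Stdlib Require Import Reals.
From Coquelicot Require Import Coquelicot.
Open Scope R_scope.

Definition Icc (a b x : R) : Prop := a <= x <= b.

(** [f] belongs to C^2([a,b]) with first and second derivatives [f'] and [f''].
    [D_in] is differentiability relative to a set, hence one-sided at [a] and
    [b]; values of the three functions outside [a,b] are irrelevant. *)
Record is_C2 (a b : R) (f f' f'' : R -> R) : Prop := {
  C2_derive1 : forall x, Icc a b x -> D_in f f' (Icc a b) x;
  C2_derive2 : forall x, Icc a b x -> D_in f' f'' (Icc a b) x;
  C2_cont0 : forall x, Icc a b x -> continue_in f (Icc a b) x;
  C2_cont1 : forall x, Icc a b x -> continue_in f' (Icc a b) x;
  C2_cont2 : forall x, Icc a b x -> continue_in f'' (Icc a b) x
}.

(** The least upper bound is taken in the extended reals; [real] returns it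
    unchanged when [g] is bounded on a nonempty [a,b], and 0 if it is infinite. *)
Definition unif_norm (a b : R) (g : R -> R) : R :=
  real (Lub_Rbar (fun y => exists x, Icc a b x /\ y = Rabs (g x))).

(* Main.v *)
Require Import Defs.
From Stdlib Require Import Reals Lra Lia.
From Coquelicot Require Import Coquelicot.
Open Scope R_scope.

(** The error on one panel [c,d] is controlled by monotonicity, without Peano
    kernels or integration by parts. Suppose F'' <= M and put
      Psi(t) = F(t) - F(c) - (t-c) F'(t) + M/2 (t-c)^2,
      Phi(t) = int_c^t F - (t-c)/2 (F(c) + F(t)) + M (t-c)^3 / 12.
    Both vanish at c. Since Psi'(t) = (t-c) (M - F''(t)) >= 0, Psi is
    nonnegative ([taylor_remainder_lower]); since Phi' = Psi/2, so is Phi, and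
    Phi(d) >= 0 is the lower bound for the error ([trapezoid_error_lower]).
    Applying this to -F gives the upper bound ([trapezoid_error]).

    The n panels of the composite rule have length h = (b-a)/n, so their errors
    add up to at most n * M h^3 / 12 = M (b-a)^3 / (12 n^2)
    ([composite_trapezoid_error]); the simple rule is the case n = 1.

    The hypotheses on f are relative to [a,b], whereas the calculus of integrals
    and derivatives wants functions on the whole line. Precomposing f, f' and
    f'' with the retraction [clamp] of the line onto [a,b] makes them continuous
    everywhere, keeps the derivatives on the open interval, and changes neither
    the integral nor the nodal values. *)

Definition clamp (a b x : R) : R := Rmax a (Rmin b x).

Lemma clamp_Icc (a b x : R) : a <= b -> Icc a b (clamp a b x).
Proof.
  intros hab; unfold Icc, clamp, Rmax, Rmin.
  destruct (Rle_dec b x); destruct (Rle_dec a _); lra.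
Qed.

Lemma clamp_id (a b x : R) : Icc a b x -> clamp a b x = x.
Proof.
  unfold Icc, clamp, Rmax, Rmin; intros hx.
  destruct (Rle_dec b x); destruct (Rle_dec a _); lra.
Qed.

(** Being 1-Lipschitz turns continuity relative to [a,b] into continuity on the
    line after precomposition. *)
Lemma clamp_lipschitz (a b x y : R) :
  a <= b -> Rabs (clamp a b x - clamp a b y) <= Rabs (x - y).
Proof.
  intros hab; unfold clamp, Rmax, Rmin.
  destruct (Rle_dec b x); destruct (Rle_dec b y);
    repeat (match goal with |- context [Rle_dec ?u ?v] => destruct (Rle_dec u v) end);
    unfold Rabs; repeat destruct (Rcase_abs _); lra.
Qed.

Lemma continuous_clamp (a b : R) (g : R -> R) : a <= b ->
  (forall x, Icc a b x -> continue_in g (Icc a b) x) ->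
  forall x, continuous (fun t => g (clamp a b t)) x.
Proof.
  intros hab hg x.
  apply continuity_pt_filterlim.
  intros eps heps.
  destruct (hg _ (clamp_Icc a b x hab) eps heps) as [alp [halp H]].
  exists alp; split; [exact halp|].
  intros y [_ hy]; simpl in *; unfold Rdist in *.
  destruct (Req_dec (clamp a b x) (clamp a b y)) as [e|ne].
  (* Limits here exclude the centre, which [clamp] may hit from other points. *)
  - rewrite e, Rminus_diag, Rabs_R0; exact heps.
  - apply H; split.
    + split; [exact (clamp_Icc a b y hab) | exact ne].
    + eapply Rle_lt_trans; [apply clamp_lipschitz, hab | exact hy].
Qed.

(** An interior point has a neighbourhood inside [a,b], where [clamp] is the
    identity and the relative derivative is the ordinary one. *)
Lemma is_derive_clamp (a b : R) (g g' : R -> R) (x : R) :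
  a < x < b -> D_in g g' (Icc a b) x ->
  is_derive (fun t => g (clamp a b t)) x (g' (clamp a b x)).
Proof.
  intros hx hD.
  assert (Icc a b x) as hIx by (unfold Icc; lra).
  rewrite (clamp_id a b x hIx).
  apply is_derive_Reals.
  intros eps heps.
  destruct (hD eps heps) as [alp [halp H]].
  assert (0 < Rmin alp (Rmin (x - a) (b - x))) as hd.
  { repeat apply Rmin_pos; lra. }
  exists (mkposreal _ hd); intros h hne hh; simpl in hh.
  assert (Rabs h < alp) as h1 by (eapply Rlt_le_trans; [exact hh | apply Rmin_l]).
  assert (Rabs h < Rmin (x - a) (b - x)) as h0
    by (eapply Rlt_le_trans; [exact hh | apply Rmin_r]).
  assert (Rabs h < x - a) as h2 by (eapply Rlt_le_trans; [exact h0 | apply Rmin_l]).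
  assert (Rabs h < b - x) as h3 by (eapply Rlt_le_trans; [exact h0 | apply Rmin_r]).
  apply Rabs_def2 in h2; apply Rabs_def2 in h3.
  assert (Icc a b (x + h)) as hIxh by (unfold Icc; lra).
  rewrite !clamp_id by assumption.
  specialize (H (x + h)); simpl in H; unfold Rdist in H.
  replace (x + h - x) with h in H by ring.
  apply H; repeat split; try exact h1; unfold Icc in *; lra.
Qed.

(** Compactness makes the supremum finite, so taking its real part does not
    replace it by 0. *)
Lemma Rabs_le_unif_norm (a b : R) (g : R -> R) : a <= b ->
  (forall x, Icc a b x -> continue_in g (Icc a b) x) ->
  forall x, Icc a b x -> Rabs (g x) <= unif_norm a b g.
Proof.
  intros hab hg x hx; unfold unif_norm.
  destruct (continuity_ab_maj (fun t => Rabs (g (clamp a b t))) a b hab)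
    as [m [hm _]].
  { intros c _; apply continuity_pt_filterlim.
    apply (continuous_comp (fun t => g (clamp a b t)) Rabs).
    - apply continuous_clamp; assumption.
    - apply continuous_Rabs. }
  destruct (Lub_Rbar_correct (fun y => exists x, Icc a b x /\ y = Rabs (g x)))
    as [hub hlub].
  assert (Rbar_le (Lub_Rbar (fun y => exists x, Icc a b x /\ y = Rabs (g x)))
            (Rabs (g (clamp a b m)))) as hfin.
  { apply hlub; intros y [t [ht ->]]; simpl.
    specialize (hm t ht); simpl in hm; rewrite (clamp_id a b t ht) in hm.
    exact hm. }
  assert (Rbar_le (Rabs (g x))
            (Lub_Rbar (fun y => exists x, Icc a b x /\ y = Rabs (g x)))) as hx'.
  { apply hub; exists x; auto. }
  destruct (Lub_Rbar _); simpl in *; tauto.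
Qed.

(** Differentiability is asked only inside the interval, since the clamped
    functions may have corners at [a] and [b]. *)
Lemma le_of_derive_nonneg (g g' : R -> R) (c d : R) : c <= d ->
  (forall t, continuous g t) ->
  (forall t, c < t < d -> is_derive g t (g' t)) ->
  (forall t, c < t < d -> 0 <= g' t) ->
  g c <= g d.
Proof.
  intros hcd hcont hder hpos.
  destruct (Rle_lt_or_eq_dec _ _ hcd) as [hlt | ->]; [|lra].
  assert (forall t, c < t < d -> derivable_pt g t) as pr.
  { intros t ht; exists (g' t); apply is_derive_Reals, hder, ht. }
  destruct (MVT g id c d pr (fun t _ => derivable_pt_id t) hlt) as [t [ht E]].
  { intros t _; apply continuity_pt_filterlim, hcont. }
  { intros t _; apply derivable_continuous_pt, derivable_pt_id. }
  rewrite derive_pt_id in E.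
  replace (derive_pt g t (pr t ht)) with (g' t) in E.
  - unfold id in E; specialize (hpos t ht); nra.
  - symmetry; apply derive_pt_eq_0, is_derive_Reals, hder, ht.
Qed.

(** The function Psi vanishes at [c] and has derivative (s-c) (M - F''(s)). *)
Lemma taylor_remainder_lower (F F' F'' : R -> R) (c d M : R) :
  (forall t, continuous F t) -> (forall t, continuous F' t) ->
  (forall t, c < t < d -> is_derive F t (F' t)) ->
  (forall t, c < t < d -> is_derive F' t (F'' t)) ->
  (forall t, c < t < d -> F'' t <= M) ->
  forall t, c <= t <= d ->
  0 <= F t - F c - (t - c) * F' t + M / 2 * (t - c) ^ 2.
Proof.
  intros contF contF' derF derF' F''_le t ht.
  pose (Psi := fun s => F s - F c - (s - c) * F' s + M / 2 * (s - c) ^ 2).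
  change (0 <= Psi t).
  replace 0 with (Psi c) by (unfold Psi; ring).
  apply (le_of_derive_nonneg Psi (fun s => (s - c) * (M - F'' s))); [lra| | |].
  - intros s; unfold Psi.
    apply (continuous_plus (fun s => F s - F c - (s - c) * F' s)).
    + apply (continuous_minus (fun s => F s - F c)).
      * apply (continuous_minus F (fun _ => F c)); [apply contF | apply continuous_const].
      * apply (continuous_mult (fun s => s - c) F'); [|apply contF'].
        apply (ex_derive_continuous (fun s => s - c)); auto_derive; trivial.
    + apply (ex_derive_continuous (fun s => M / 2 * (s - c) ^ 2)).
      auto_derive; trivial.
  - intros s hs.
    assert (c < s < d) as hs' by lra.
    unfold Psi; auto_derive.
    + repeat split; eexists; [apply derF | apply derF']; exact hs'.
    + rewrite (is_derive_unique (fun x : R => F x) s _ (derF s hs')).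
      rewrite (is_derive_unique (fun x : R => F' x) s _ (derF' s hs')).
      field.
  - intros s hs; specialize (F''_le s ltac:(lra)); nra.
Qed.

(** The function Phi vanishes at [c], and its derivative is half the nonnegative
    quantity of [taylor_remainder_lower]. *)
Lemma trapezoid_error_lower (F F' F'' : R -> R) (c d M : R) : c <= d ->
  (forall t, continuous F t) -> (forall t, continuous F' t) ->
  (forall t, c < t < d -> is_derive F t (F' t)) ->
  (forall t, c < t < d -> is_derive F' t (F'' t)) ->
  (forall t, c < t < d -> F'' t <= M) ->
  - (M * (d - c) ^ 3 / 12) <= RInt F c d - (d - c) / 2 * (F c + F d).
Proof.
  intros hcd contF contF' derF derF' F''_le.
  pose (Phi := fun t => RInt F c t - (t - c) / 2 * (F c + F t) + M * (t - c) ^ 3 / 12).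
  assert (forall t, is_derive (fun u => RInt F c u) t (F t)) as derI.
  { intros t; apply (is_derive_RInt F _ c).
    - apply filter_forall; intros u.
      apply (RInt_correct (V := R_CompleteNormedModule)), ex_RInt_continuous; intros; apply contF.
    - apply contF. }
  assert (Phi c <= Phi d) as H.
  { apply (le_of_derive_nonneg Phi
      (fun s => (F s - F c - (s - c) * F' s + M / 2 * (s - c) ^ 2) / 2));
      [lra| | |].
    - intros s; unfold Phi.
      apply (continuous_plus (fun t => RInt F c t - (t - c) / 2 * (F c + F t))).
      + apply (continuous_minus (fun t => RInt F c t)).
        * apply (ex_derive_continuous (fun t => RInt F c t)); eexists; apply derI.
        * apply (continuous_mult (fun s => (s - c) / 2) (fun s => F c + F s)).
          -- apply (ex_derive_continuous (fun s => (s - c) / 2)); auto_derive; trivial.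
          -- apply (continuous_plus (fun _ => F c) F); [apply continuous_const | apply contF].
      + apply (ex_derive_continuous (fun s => M * (s - c) ^ 3 / 12)).
        auto_derive; trivial.
    - intros s hs.
      assert (is_derive (fun t => (t - c) / 2 * (F c + F t)) s
                ((F c + F s) / 2 + (s - c) / 2 * F' s)) as D2.
      { auto_derive.
        - eexists; apply derF, hs.
        - rewrite (is_derive_unique (fun x : R => F x) s _ (derF s hs)); field. }
      assert (is_derive (fun t => M * (t - c) ^ 3 / 12) s (M * (s - c) ^ 2 / 4)) as D3.
      { auto_derive; [trivial | field]. }
      pose proof (is_derive_plus _ _ s _ _
        (is_derive_minus _ _ s _ _ (derI s) D2) D3) as D.
      evar_last; [exact D|].
      unfold plus, minus, opp; simpl; unfold plus, opp; simpl; field.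
    - intros s hs; pose proof (taylor_remainder_lower F F' F'' c d M
        contF contF' derF derF' F''_le s ltac:(lra)); lra. }
  unfold Phi in H; rewrite RInt_point in H.
  unfold zero in H; simpl in H; lra.
Qed.

Lemma trapezoid_error (F F' F'' : R -> R) (c d M : R) : c <= d ->
  (forall t, continuous F t) -> (forall t, continuous F' t) ->
  (forall t, c < t < d -> is_derive F t (F' t)) ->
  (forall t, c < t < d -> is_derive F' t (F'' t)) ->
  (forall t, c < t < d -> Rabs (F'' t) <= M) ->
  Rabs (RInt F c d - (d - c) / 2 * (F c + F d)) <= M * (d - c) ^ 3 / 12.
Proof.
  intros hcd c0 c1 d0 d1 hM.
  assert (- (M * (d - c) ^ 3 / 12) <= RInt F c d - (d - c) / 2 * (F c + F d)) as H1.
  { apply (trapezoid_error_lower F F' F''); auto.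
    intros t ht; apply Rabs_le_between, hM, ht. }
  assert (- (M * (d - c) ^ 3 / 12) <=
    RInt (fun t => - F t) c d - (d - c) / 2 * (- F c + - F d)) as H2.
  { apply (trapezoid_error_lower (fun t => - F t) (fun t => - F' t) (fun t => - F'' t)); auto.
    - intros t; apply (continuous_opp F), c0.
    - intros t; apply (continuous_opp F'), c1.
    - intros t ht; apply (is_derive_opp F), d0, ht.
    - intros t ht; apply (is_derive_opp F'), d1, ht.
    - intros t ht; specialize (hM t ht); apply Rabs_le_between in hM; lra. }
  assert (RInt (fun t => - F t) c d = - RInt F c d) as E.
  { apply (RInt_opp (V := R_CompleteNormedModule)), ex_RInt_continuous; intros; apply c0. }
  rewrite E in H2.
  apply Rabs_le_between; lra.
Qed.

(** Each new panel turns the old end node into an interior one, which doubles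
    its weight. The induction is on the number of interior nodes, so that its
    base case is the simple rule with an empty sum. *)
Lemma composite_trapezoid_error (F F' F'' : R -> R) (x : nat -> R) (h M : R) (k : nat) :
  0 <= h ->
  (forall t, continuous F t) -> (forall t, continuous F' t) ->
  (forall t, x 0%nat < t < x (S k) -> is_derive F t (F' t)) ->
  (forall t, x 0%nat < t < x (S k) -> is_derive F' t (F'' t)) ->
  (forall t, x 0%nat < t < x (S k) -> Rabs (F'' t) <= M) ->
  (forall i, (i <= S k)%nat -> x i = x 0%nat + INR i * h) ->
  Rabs (RInt F (x 0%nat) (x (S k)) -
        h / 2 * (F (x 0%nat) + 2 * sum_n_m (fun i => F (x i)) 1 k + F (x (S k))))
    <= INR (S k) * (M * h ^ 3 / 12).
Proof.
  intros hh c0 c1; induction k as [|k IH]; intros d0 d1 hM hx.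
  - rewrite sum_n_m_zero by lia; unfold zero; simpl.
    pose proof (hx 1%nat ltac:(lia)) as e; simpl in e.
    pose proof (trapezoid_error F F' F'' (x 0%nat) (x 1%nat) M ltac:(lra) c0 c1 d0 d1 hM) as H.
    replace (x 1%nat - x 0%nat) with h in H by lra.
    rewrite Rmult_0_r, Rplus_0_r, Rmult_1_l; exact H.
  - pose proof (hx (S k) ltac:(lia)) as e1.
    pose proof (hx (S (S k)) ltac:(lia)) as e2.
    pose proof (pos_INR (S k)) as hp.
    rewrite (S_INR (S k)) in e2 |- *.
    assert (0 <= INR (S k) * h) by (apply Rmult_le_pos; assumption).
    assert (x (S (S k)) = x (S k) + h) as e3 by lra.
    assert (Rabs (RInt F (x (S k)) (x (S (S k))) -
              (x (S (S k)) - x (S k)) / 2 * (F (x (S k)) + F (x (S (S k)))))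
            <= M * (x (S (S k)) - x (S k)) ^ 3 / 12) as H1.
    { apply (trapezoid_error F F' F''); auto; try lra;
        intros t ht; [apply d0 | apply d1 | apply hM]; lra. }
    replace (x (S (S k)) - x (S k)) with h in H1 by lra.
    specialize (IH ltac:(intros; apply d0; lra) ltac:(intros; apply d1; lra)
      ltac:(intros; apply hM; lra) ltac:(intros; apply hx; lia)).
    assert (RInt F (x 0%nat) (x (S k)) + RInt F (x (S k)) (x (S (S k)))
            = RInt F (x 0%nat) (x (S (S k)))) as E.
    { apply (RInt_Chasles (V := R_CompleteNormedModule));
        apply ex_RInt_continuous; intros; apply c0. }
    rewrite <- E, sum_n_Sm by lia.
    unfold plus; simpl plus.
    apply Rabs_le_between in H1; apply Rabs_le_between in IH.
    apply Rabs_le_between; simpl in *; lra.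
Qed.

Theorem mainTheorem2 (a b : R) (hab : a < b) (f f' f'' : R -> R)
    (hf : is_C2 a b f f' f'') :
  (forall ET : R,
     RInt f a b = (b - a) / 2 * (f a + f b) + ET ->
     Rabs ET <= (b - a) ^ 3 * unif_norm a b f'' / 12) /\
  (forall n : nat, (1 <= n)%nat ->
   forall x : nat -> R,
     (forall i : nat, (i <= n)%nat -> x i = a + (b - a) * INR i / INR n) ->
   forall ETn : R,
     RInt f a b =
       (b - a) / (2 * INR n) *
         (f a + 2 * sum_n_m (fun i => f (x i)) 1 (n - 1) + f b) + ETn ->
     Rabs ETn <= (b - a) ^ 3 * unif_norm a b f'' / (12 * INR n ^ 2)).
Proof.
  assert (forall n : nat, (1 <= n)%nat ->
   forall x : nat -> R,
     (forall i : nat, (i <= n)%nat -> x i = a + (b - a) * INR i / INR n) ->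
   forall ETn : R,
     RInt f a b =
       (b - a) / (2 * INR n) *
         (f a + 2 * sum_n_m (fun i => f (x i)) 1 (n - 1) + f b) + ETn ->
     Rabs ETn <= (b - a) ^ 3 * unif_norm a b f'' / (12 * INR n ^ 2)) as Hn.
  { intros n hn x hx ETn hE.
    assert (0 < INR n) as hn0 by (apply lt_0_INR; lia).
    assert (x 0%nat = a) as ea.
    { rewrite hx by lia; simpl; field; lra. }
    assert (x n = b) as eb.
    { rewrite hx by lia; field; lra. }
    (* The clamped integrand agrees with [f] on [a,b], hence at all the nodes. *)
    pose (F := fun t => f (clamp a b t)).
    assert (forall t, Icc a b t -> F t = f t) as hF.
    { intros t ht; unfold F; rewrite clamp_id; auto. }
    assert (forall i, (i <= n)%nat -> Icc a b (x i)) as hxI.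
    { intros i hi; rewrite hx by exact hi.
      apply le_INR in hi; pose proof (pos_INR i).
      assert (0 <= INR i / INR n <= 1) as hq.
      { split; [apply Rdiv_le_0_compat; lra|].
        apply Rle_div_l; lra. }
      unfold Icc, Rdiv in *; rewrite Rmult_assoc; nra. }
    assert (0 <= (b - a) / INR n) as hh by (apply Rdiv_le_0_compat; lra).
    destruct hf as [D1 D2 C0 C1 C2].
    destruct n as [|k]; [lia|].
    pose proof (composite_trapezoid_error F (fun t => f' (clamp a b t))
      (fun t => f'' (clamp a b t)) x ((b - a) / INR (S k)) (unif_norm a b f'') k hh) as H.
    rewrite ea, eb in H.
    rewrite (RInt_ext F f) in H.
    2:{ rewrite Rmin_left, Rmax_right by lra; intros t ht; apply hF; unfold Icc; lra. }
    rewrite (sum_n_m_ext_loc _ (fun i => f (x i)) 1 k) in H.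
    2:{ intros i hi; apply hF, hxI; lia. }
    rewrite !hF in H by (unfold Icc; lra).
    replace (S k - 1)%nat with k in hE by lia.
    replace ETn with (RInt f a b - (b - a) / INR (S k) / 2 *
      (f a + 2 * sum_n_m (fun i => f (x i)) 1 k + f b)).
    2:{ rewrite hE; field; lra. }
    eapply Rle_trans; [apply H|].
    - apply continuous_clamp; [lra | exact C0].
    - apply continuous_clamp; [lra | exact C1].
    - intros t ht; apply is_derive_clamp; [exact ht | apply D1; unfold Icc; lra].
    - intros t ht; apply is_derive_clamp; [exact ht | apply D2; unfold Icc; lra].
    - intros t ht; apply Rabs_le_unif_norm; [lra | exact C2 | apply clamp_Icc; lra].
    - intros i hi; rewrite hx by exact hi; field; lra.
    - apply Req_le; field; lra. }
  split; [|exact Hn].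
  (* With n = 1 there are no interior nodes. *)
  intros ET hE.
  specialize (Hn 1%nat ltac:(lia) (fun i => a + (b - a) * INR i / INR 1)
    ltac:(intros; reflexivity) ET).
  rewrite sum_n_m_zero in Hn by (simpl; lia).
  unfold zero in Hn; simpl in Hn.
  eapply Rle_trans; [apply Hn | apply Req_le; simpl; field].
  rewrite hE; field.
Qed.
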